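(* Let $S$ be a finitely presented right abundant semigroup (for example, a finitely presented regular semigroup). If $R$ is an $\mathscr R$-class of $S$ containing only finitely many $\mathscr H$-classes, then the Schützenberger group of $R$ is finitely presented.
   Context: $S^1$ denotes $S$ with an identity adjoined. Green's relations: $s\mathrel{\mathscr R}t$ iff $sS^1=tS^1$; $s\mathrel{\mathscr L}t$ iff $S^1s=S^1t$; $\mathscr H=\mathscr L\cap\mathscr R$. Define $s\mathrel{\mathscr L^*}t$ if for all $x,y\in S^1$ one has $sx=sy$ if and only if $tx=ty$. A semigroup is right abundant if each $\mathscr L^*$-class contains an idempotent. For an $\mathscr R$-class $R$, let $\mathrm{St}(R)=\{s\in S^1\mid sR\subseteq R\}$, acting on $R$ by left multiplication. The quotient of $\mathrm{St}(R)$ by its action on $R$ (identify $s,t\in\mathrm{St}(R)$ when $sr=tr$ for all $r\in R$) is a group $G(R)$, called the Schützenberger group of $R$; its orbits on $R$ are exactly the $\mathscr H$-classes contained in $R$. *)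

(* Defs.v *)
From HB Require Import structures.
From mathcomp Require Import all_boot.
From mathcomp Require Import boolp classical_sets functions cardinality.

Set Implicit Arguments.
Unset Strict Implicit.
Unset Printing Implicit Defensive.

Import Algebra.

Local Open Scope classical_set_scope.
Local Open Scope group_scope.
Local Open Scope quotient_scope.

(* The congruence on M generated by the relation E. *)
Inductive cong_gen (M : magmaType) (E : M -> M -> Prop) : M -> M -> Prop :=
| cong_base u v : E u v -> cong_gen E u v
| cong_refl u : cong_gen E u u
| cong_sym u v : cong_gen E u v -> cong_gen E v u
| cong_trans u v w : cong_gen E u v -> cong_gen E v w -> cong_gen E u w
| cong_mul u u' v v' :
    cong_gen E u u' -> cong_gen E v v' -> cong_gen E (u * v) (u' * v').

Definition freeMonoid (A : Type) : Type := seq A.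

HB.instance Definition _ (A : choiceType) := Choice.on (freeMonoid A).
HB.instance Definition _ (A : choiceType) :=
  isMonoid.Build (freeMonoid A) (@catA A) (@cat0s A) (@cats0 A).

Definition freeSemigroup (A : eqType) : Type := {w : seq A | w != [::]}.

Section FreeSemigroup.
Variable A : choiceType.

HB.instance Definition _ := Choice.on (freeSemigroup A).

Lemma freeSemigroup_mul_subproof (u v : freeSemigroup A) :
  val u ++ val v != [::].
Proof. by case: u => [[|a u]]. Qed.

Definition freeSemigroup_mul (u v : freeSemigroup A) : freeSemigroup A :=
  exist _ (val u ++ val v) (freeSemigroup_mul_subproof u v).

Lemma freeSemigroup_mulA : associative freeSemigroup_mul.
Proof. by move=> u v w; apply: val_inj; rewrite /= catA. Qed.

HB.instance Definition _ :=
  isSemigroup.Build (freeSemigroup A) freeSemigroup_mulA.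

End FreeSemigroup.

Definition fp_semigroup (S : semigroupType) : Prop :=
  exists (A : finType) (E : seq (freeSemigroup A * freeSemigroup A))
         (f : {multiplicative freeSemigroup A -> S}),
    (forall s, exists w, f w = s) /\
    (forall u v, f u = f v <-> cong_gen (fun x y => (x, y) \in E) u v).

(* Group words are words over A * bool: the letter (a, true) stands for a and
   (a, false) for its formal inverse. *)
Definition gword (A : Type) : Type := freeMonoid (A * bool).

HB.instance Definition _ (A : choiceType) := Monoid.on (gword A).

Definition gword_eval (G : groupType) (A : choiceType) (g : A -> G)
    (w : gword A) : G :=
  \prod_(x <- w) (if x.2 then g x.1 else (g x.1)^-1).

(* Modulo the generated congruence, the group words form the quotient of the
   free group on A by the normal closure of the relators in E. *)
Inductive group_rel (A : choiceType) (E : seq (gword A)) :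
    gword A -> gword A -> Prop :=
| group_rel_cancel (a : A) (b : bool) : group_rel E [:: (a, b); (a, ~~ b)] 1
| group_rel_relator (w : gword A) : w \in E -> group_rel E w 1.

Definition fp_group (G : groupType) : Prop :=
  exists (A : finType) (E : seq (gword A)) (g : A -> G),
    (forall x, exists w, gword_eval g w = x) /\
    (forall u v, gword_eval g u = gword_eval g v <->
                 cong_gen (group_rel E) u v).

(* S with a new identity adjoined, even when S already has one. *)
Definition adj1 (S : Type) : Type := option S.

Section Adj1.
Variable S : semigroupType.

HB.instance Definition _ := Choice.on (adj1 S).

Definition adj1_mul (x y : adj1 S) : adj1 S :=
  match x, y with
  | None, _ => y
  | _, None => x
  | Some s, Some t => Some (s * t)
  end.

Lemma adj1_mulA : associative adj1_mul.
Proof. by move=> [s|] [t|] [u|] //=; rewrite mulgA. Qed.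

Lemma adj1_mul1 : left_id None adj1_mul. Proof. by []. Qed.

Lemma adj1_mulr1 : right_id None adj1_mul. Proof. by case. Qed.

HB.instance Definition _ :=
  isMonoid.Build (adj1 S) adj1_mulA adj1_mul1 adj1_mulr1.

Definition inj1 (s : S) : adj1 S := Some s.

Lemma inj1M (s t : S) : inj1 (s * t) = inj1 s * inj1 t.
Proof. by []. Qed.

Lemma inj1_inj : injective inj1. Proof. by move=> s t []. Qed.

End Adj1.

Section Green.
Variable S : semigroupType.

Definition greenR (s t : S) : Prop :=
  [set inj1 s * x | x in [set: adj1 S]] = [set inj1 t * x | x in [set: adj1 S]].

Definition greenL (s t : S) : Prop :=
  [set x * inj1 s | x in [set: adj1 S]] = [set x * inj1 t | x in [set: adj1 S]].

Definition greenH (s t : S) : Prop := greenL s t /\ greenR s t.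

Definition R_class (R : set S) : Prop := exists s, R = [set t | greenR s t].

Definition H_class (H : set S) : Prop := exists s, H = [set t | greenH s t].

Definition starL (s t : S) : Prop :=
  forall x y : adj1 S,
    inj1 s * x = inj1 s * y <-> inj1 t * x = inj1 t * y.

Definition starL_class (L : set S) : Prop := exists s, L = [set t | starL s t].

Definition right_abundant : Prop :=
  forall L, starL_class L -> exists2 e, L e & e * e = e.

Definition regular : Prop := forall s : S, exists t, s * t * s = s.

Lemma regular_right_abundant : regular -> right_abundant.
Proof.
move=> reg _ [s ->]; have [t sts] := reg s; exists (t * s); last first.
  by rewrite -mulgA (mulgA s) sts.
move=> x y; rewrite inj1M -!mulgA; split => [->//|/(congr1 (fun z => inj1 s * z))].
by rewrite !mulgA -!inj1M sts.
Qed.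

Definition finitely_many_H (R : set S) : Prop :=
  finite_set [set H | H_class H /\ H `<=` R].

End Green.

Section Stabilizer.
Variables (S : semigroupType) (R : set S).

Definition stab : set (adj1 S) :=
  [set s | [set s * x | x in @inj1 S @` R] `<=` @inj1 S @` R].

Lemma stab1 : stab 1.
Proof. by move=> _ [x Rx <-]; rewrite mul1g. Qed.

Lemma stabM (s t : adj1 S) : stab s -> stab t -> stab (s * t).
Proof.
by move=> ss st _ [x Rx <-]; rewrite -mulgA; apply: ss; exists (t * x) => //;
  apply: st; exists x.
Qed.

Definition stabType : Type := {s : adj1 S | s \in stab}.

HB.instance Definition _ := SubChoice.on stabType.

Lemma stab_umagma_closed : umagma_closed (fun s => s \in stab).
Proof.
split; first by apply/mem_set; exact: stab1.
by move=> s t /set_mem ss /set_mem st; apply/mem_set; exact: stabM.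
Qed.

HB.instance Definition _ :=
  SubChoice_isSubMonoid.Build (adj1 S) (fun s => s \in stab) stabType
    stab_umagma_closed.

Definition stab_eq (s t : stabType) : bool :=
  `[< forall r, R r -> val s * inj1 r = val t * inj1 r >].

Lemma stab_eq_refl : reflexive stab_eq.
Proof. by move=> s; apply/asboolP. Qed.

Lemma stab_eq_sym : symmetric stab_eq.
Proof. by move=> s t; apply/asboolP/asboolP => st r Rr; rewrite st. Qed.

Lemma stab_eq_trans : transitive stab_eq.
Proof.
move=> t s u /asboolP st /asboolP tu; apply/asboolP => r Rr.
by rewrite st ?tu.
Qed.

Canonical stab_equiv :=
  EquivRel stab_eq stab_eq_refl stab_eq_sym stab_eq_trans.

Lemma stab_eqM (s s' t t' : stabType) :
  stab_eq s s' -> stab_eq t t' -> stab_eq (s * t) (s' * t').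
Proof.
move=> /asboolP ss /asboolP tt; apply/asboolP => r Rr.
rewrite !gmulfM -!mulgA tt //.
have /set_mem/(_ (val t' * inj1 r)) [|r' Rr' <-] := valP t'.
  by exists (inj1 r) => //; exists r.
exact: ss.
Qed.

(* St(R) modulo its action on R; in general only a monoid. *)
Definition schutz_monoid : Type := {eq_quot stab_equiv}.

HB.instance Definition _ := Choice.on schutz_monoid.
HB.instance Definition _ := EqQuotient.on schutz_monoid.

Definition schutz_mul (x y : schutz_monoid) : schutz_monoid :=
  \pi_schutz_monoid (repr x * repr y).

Definition schutz_one : schutz_monoid := \pi_schutz_monoid 1.

Lemma schutz_mul_pi (s t : stabType) :
  schutz_mul (\pi s) (\pi t) = \pi_schutz_monoid (s * t).
Proof.
apply/eqmodP/stab_eqM; apply/eqmodP; exact: reprK.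
Qed.

Lemma schutz_mulA : associative schutz_mul.
Proof.
move=> x y z; rewrite -(reprK x) -(reprK y) -(reprK z).
by rewrite !schutz_mul_pi mulgA.
Qed.

Lemma schutz_mul1 : left_id schutz_one schutz_mul.
Proof. by move=> x; rewrite -(reprK x) schutz_mul_pi mul1g. Qed.

Lemma schutz_mulr1 : right_id schutz_one schutz_mul.
Proof. by move=> x; rewrite -(reprK x) schutz_mul_pi mulg1. Qed.

HB.instance Definition _ :=
  isMonoid.Build schutz_monoid schutz_mulA schutz_mul1 schutz_mulr1.

End Stabilizer.

Section SchutzGroup.
Variable S : semigroupType.
Implicit Types (R : set S) (r s t : S).

Lemma greenRP s t :
  greenR s t <-> (exists x, inj1 t = inj1 s * x) /\ exists y, inj1 s = inj1 t * y.
Proof.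
split=> [st|[[x tx] [y sy]]].
  split.
    have : [set inj1 t * x | x in [set: adj1 S]] (inj1 t).
      by exists 1 => //; rewrite mulg1.
    by rewrite -st => -[x _ <-]; exists x.
  have : [set inj1 s * x | x in [set: adj1 S]] (inj1 s).
    by exists 1 => //; rewrite mulg1.
  by rewrite st => -[x _ <-]; exists x.
rewrite /greenR eqEsubset; split => _ [z _ <-].
  by exists (y * z) => //; rewrite mulgA -sy.
by exists (x * z) => //; rewrite mulgA -tx.
Qed.

Lemma greenLP s t :
  greenL s t <-> (exists x, inj1 t = x * inj1 s) /\ exists y, inj1 s = y * inj1 t.
Proof.
split=> [st|[[x tx] [y sy]]].
  split.
    have : [set x * inj1 t | x in [set: adj1 S]] (inj1 t).
      by exists 1 => //; rewrite mul1g.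
    by rewrite -st => -[x _ <-]; exists x.
  have : [set x * inj1 s | x in [set: adj1 S]] (inj1 s).
    by exists 1 => //; rewrite mul1g.
  by rewrite st => -[x _ <-]; exists x.
rewrite /greenL eqEsubset; split => _ [z _ <-].
  by exists (z * y) => //; rewrite -mulgA -sy.
by exists (z * x) => //; rewrite -mulgA -tx.
Qed.

Lemma R_classE R r0 r : R_class R -> R r0 -> R r <-> greenR r0 r.
Proof.
by move=> [s ->]; rewrite /greenR /= => <-.
Qed.

Lemma stab_pow R (s : adj1 S) r n :
  stab R s -> R r -> exists2 r', R r' & inj1 r' = s ^+ n * inj1 r.
Proof.
move=> ss Rr; elim: n => [|n [r' Rr' e]].
  by exists r => //; rewrite expg0 mul1g.
have [|r'' Rr'' e'] := ss (s * inj1 r'); first by exists (inj1 r') => //; exists r'.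
by exists r'' => //; rewrite e' e expgS mulgA.
Qed.

Lemma schutz_left_inv R (s : adj1 S) :
  R_class R -> finitely_many_H R -> stab R s ->
  exists2 t, stab R t & forall r, R r -> t * s * inj1 r = inj1 r.
Proof.
move=> RR Rfin ss; have [r0 R0] : exists r, R r.
  by have [r ->] := RR; exists r.
pose p n := sval (cid2 (stab_pow n ss R0)).
have pR n : R (p n) by rewrite /p; case: cid2.
have pE n : inj1 (p n) = s ^+ n * inj1 r0 by rewrite /p; case: cid2.
pose h n := [set t | greenH (p n) t].
have /existsNP[i /existsNP[j]] : ~ forall i j, h i = h j -> i = j.
  move=> hinj; apply: infinite_nat.
  have := @finite_preimage _ _ _ h _ Rfin.
  have -> : h @^-1` [set H | H_class H /\ H `<=` R] = [set: nat].
    rewrite eqEsubset; split=> // n _; split; first by exists (p n).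
    by move=> t [_ pt]; apply/(R_classE _ RR (pR n)).
  by apply=> x y _ _; exact: hinj.
wlog ij : i j / i < j => [th /not_implyP[hij /eqP]|].
  by rewrite neq_ltn => /orP[ij|ij]; [apply: (th i j)|apply: (th j i)] => //;
    apply/not_implyP; split=> // /eqP; rewrite ?(ltn_eqF ij).
move=> /not_implyP[hij _].
have /greenLP[_ [u]] : greenL (p i) (p j).
  have : h j (p j) by split.
  by rewrite -hij => -[].
rewrite !pE => uE.
have [v vE] : exists v, inj1 r0 = s * inj1 r0 * v.
  have [/= _ [v ve]] := (greenRP r0 (p 1%N)).1 ((R_classE _ RR R0).1 (pR 1%N)).
  by exists v; rewrite -[s in RHS]expg1 -pE.
have can n : s ^+ n * inj1 r0 * v ^+ n = inj1 r0.
  elim: n => [|n IH]; first by rewrite !expg0 mulg1 mul1g.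
  by rewrite expgSr expgS -!mulgA (mulgA (inj1 r0)) !mulgA -(mulgA (s ^+ n))
    -(mulgA (s ^+ n)) -vE.
pose t := u * s ^+ (j - i).-1.
have ts0 : t * s * inj1 r0 = inj1 r0.
  rewrite -[RHS](can i) uE /t -{2}(subnK (ltnW ij)) expgnDr.
  rewrite -!mulgA (mulgA _ _ (v ^+ i)) can.
  have {2}-> : j - i = (j - i).-1.+1 by rewrite prednK ?subn_gt0.
  by rewrite expgSr !mulgA.
have ts r : R r -> t * s * inj1 r = inj1 r.
  move=> /(R_classE _ RR R0)/greenRP[[x ->] _].
  by rewrite mulgA ts0.
exists t => // _ [_ [r Rr <-] <-].
have [w Rw we] : exists2 w, R w & inj1 w = s * inj1 r0.
  by exists (p 1%N) => //; rewrite pE expg1.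
have /greenRP[[x xE] [y yE]] : greenR w r by apply/(R_classE _ RR Rw).
have [q qE] : exists q, inj1 q = t * inj1 r.
  by case: (t) => [a|]; [exists (a * r)|exists r].
exists q => //; apply/(R_classE _ RR R0)/greenRP; split.
  by exists x; rewrite qE xE we !mulgA ts0.
by exists y; rewrite qE -mulgA -yE we mulgA ts0.
Qed.

End SchutzGroup.

(* The group structure needs the finiteness hypothesis: for the R-class of the
   identity of the bicyclic monoid, schutz_monoid R is (nat, +). *)
Definition schutz (S : semigroupType) (R : set S) (RR : R_class R)
  (Rfin : finitely_many_H R) : Type := schutz_monoid R.

Section SchutzGroupStructure.
Variables (S : semigroupType) (R : set S).
Hypotheses (RR : R_class R) (Rfin : finitely_many_H R).

Local Notation G := (schutz RR Rfin).

HB.instance Definition _ := Monoid.copy G (schutz_monoid R).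

Lemma schutz_inv_subproof (x : G) : exists y : G, y * x = 1.
Proof.
have [t st tE] := schutz_left_inv RR Rfin (set_mem (valP (repr x))).
exists (\pi_(schutz_monoid R) (exist _ t (mem_set st) : stabType R) : G).
rewrite -[x in LHS]reprK; apply: (etrans (schutz_mul_pi _ _)).
apply/eqmodP/asboolP => r Rr; rewrite gmulfM gmulf1 mul1g; exact: tE.
Qed.

Definition schutz_inv (x : G) : G := sval (cid (schutz_inv_subproof x)).

Lemma schutz_mulVg : left_inverse 1 schutz_inv (fun x y : G => x * y).
Proof. by move=> x; rewrite /schutz_inv; case: cid. Qed.

Lemma schutz_mulgV : right_inverse 1 schutz_inv (fun x y : G => x * y).
Proof.
have mulVg x : schutz_inv x * x = 1 by exact: schutz_mulVg.
move=> x; rewrite -[LHS]mul1g -[1 in LHS](mulVg (schutz_inv x)).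
by rewrite -mulgA (mulgA (schutz_inv x)) mulVg mul1g mulVg.
Qed.

HB.instance Definition _ := hasInv.Build G schutz_inv.
HB.instance Definition _ := Monoid_isGroup.Build G schutz_mulVg schutz_mulgV.

End SchutzGroupStructure.

(* Main.v *)
Require Import Defs.
From HB Require Import structures.
From mathcomp Require Import all_boot.
From mathcomp Require Import boolp classical_sets functions cardinality.

Set Implicit Arguments.
Unset Strict Implicit.
Unset Printing Implicit Defensive.

Import Algebra.

Local Open Scope classical_set_scope.
Local Open Scope group_scope.
Local Open Scope quotient_scope.

(** The Schützenberger group [G] acts on [R] from the left, freely, with the
H-classes of [R] as orbits, and this action commutes with right multiplication.
Let [A] generate [S].  The graph with vertex set [R] and an edge from [r] to
[r * a] whenever both lie in [R] is strongly connected, and [G] acts freely on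
it with finitely many orbits of vertices and edges.  Glue to it, for every
defining relation [u = v] of [S] and every [r] with [r * u] in [R], a 2-cell
bounded by the two paths from [r] spelled [u] and [v]; these 2-cells also fall
into finitely many orbits.  A group acting freely and with finite quotient on a
simply connected 2-complex is finitely presented, so the point is that the
complex is simply connected.

By strong connectedness a backward edge is homotopic to a forward path as soon
as directed loops are null-homotopic, so only directed loops matter.  Let [w]
spell a directed loop at [r], that is, [r * w = r].  Right abundance gives an
idempotent [e] that is starL-related to [r].  From [e * e = e] one gets
[r * e = r], and from [r * w = r] one gets [e * w = e].  If the word [p] spells
[e], then [p * w] can be rewritten to [p] with the defining relations.  As [p]
labels a loop at [r], the whole rewriting takes place along paths inside [R],
hence [p * w] and [p] are homotopic loops and [w] is null-homotopic
([quotient_simply_connected]).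

The topology is replaced by its quotient by [G].  Choosing a representative
[r_i] in each H-class, every edge reads [r_i * a = x * r_k] with a unique [x] in
[G]; so the quotient is a finite automaton whose edges carry elements of [G]
(voltages), and the original graph is recovered as its derived graph.
[fp_group_voltage] is the statement about 2-complexes in these terms: [G] is
presented by the edges of the automaton, subject to the relations read off from
the 2-cells and to the triviality of finitely many connecting paths. *)

(** * Group words *)

Section GroupWords.
Variable X : choiceType.

Definition gword_inv (w : gword X) : gword X :=
  rev [seq (x.1, ~~ x.2) | x <- w].

Section Evaluation.
Variables (G : groupType) (g : X -> G).

Lemma gword_eval1 : gword_eval g 1 = 1.
Proof. exact: big_nil. Qed.

Lemma gword_evalM (u v : gword X) :
  gword_eval g (u * v) = gword_eval g u * gword_eval g v.
Proof. exact: big_cat. Qed.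

Lemma gword_eval_letter x : gword_eval g [:: (x, true)] = g x.
Proof. by rewrite /gword_eval big_seq1. Qed.

Lemma gword_evalV (w : gword X) :
  gword_eval g (gword_inv w) = (gword_eval g w)^-1.
Proof.
elim: w => [|[x b] w IH]; first by rewrite /gword_eval !big_nil invg1.
have -> : gword_inv ((x, b) :: w) = gword_inv w * [:: (x, ~~ b)].
  by rewrite /gword_inv /= rev_cons -cats1.
rewrite gword_evalM IH /gword_eval !big_cons big_nil mulg1 invgM /=.
by case: b; rewrite /= ?invgK.
Qed.

End Evaluation.

Variable E : seq (gword X).
Local Notation "u ~ v" := (cong_gen (group_rel E) u v) (at level 70).

Lemma gword_cong_mull (p u v : gword X) : u ~ v -> p * u ~ p * v.
Proof. exact: cong_mul (cong_refl _ _). Qed.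

Lemma gword_cong_mulr (p u v : gword X) : u ~ v -> u * p ~ v * p.
Proof. by move/cong_mul; apply; exact: cong_refl. Qed.

Lemma gword_mulwV (w : gword X) : w * gword_inv w ~ 1.
Proof.
elim: w => [|[x b] w IH]; first exact: cong_refl.
have -> : ((x, b) :: w : gword X) * gword_inv ((x, b) :: w) =
    ([:: (x, b)] : gword X) *
      ((w : gword X) * gword_inv w * ([:: (x, ~~ b)] : gword X)).
  rewrite /gword_inv /= rev_cons -cats1.
  by rewrite -[LHS](catA [:: _] w) -[X in _ = _ * X]mulgA.
apply: cong_trans (cong_base (group_rel_cancel E x b)).
by apply: (gword_cong_mull [:: _]); exact: gword_cong_mulr IH.
Qed.

Lemma gword_invK : involutive gword_inv.
Proof.
move=> w; rewrite /gword_inv map_rev revK -map_comp -[RHS]map_id.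
by apply: eq_map => -[x b] /=; rewrite negbK.
Qed.

Lemma gword_mulVw (w : gword X) : gword_inv w * w ~ 1.
Proof. by rewrite -{2}(gword_invK w); exact: gword_mulwV. Qed.

Lemma gword_cong_cancel (p u v : gword X) : p * u ~ p * v -> u ~ v.
Proof.
have pK w : gword_inv p * (p * w) ~ w.
  by rewrite mulgA; have := gword_cong_mulr w (gword_mulVw p); rewrite mul1g.
move=> /(gword_cong_mull (gword_inv p)) puv.
by apply: cong_trans (pK v); apply: cong_trans puv; apply: cong_sym; apply: pK.
Qed.

Lemma gword_cong_div (u v : gword X) : u * gword_inv v ~ 1 <-> u ~ v.
Proof.
split=> [/(gword_cong_mulr v)|/(gword_cong_mulr (gword_inv v)) uv].
  rewrite mul1g -mulgA; apply: cong_trans; apply: cong_sym.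
  by have := gword_cong_mull u (gword_mulVw v); rewrite mulg1.
by apply: cong_trans uv _; exact: gword_mulwV.
Qed.

(** Soundness of a presentation: von Dyck's theorem for group words. *)
Lemma cong_relator_eval (G : groupType) (g : X -> G) :
  (forall w, w \in E -> gword_eval g w = 1) ->
  forall u v, u ~ v -> gword_eval g u = gword_eval g v.
Proof.
move=> gE u v; elim=> {u v} [_ _ [x b|w wE]|//|//|u v w _ -> //|].
- rewrite gword_eval1 /gword_eval big_cons big_seq1 /=.
  by case: b; rewrite /= ?mulgV ?mulVg.
- by rewrite gword_eval1 gE.
- by move=> u u' v v' _ uu' _ vv'; rewrite !gword_evalM uu' vv'.
Qed.

End GroupWords.

(** * Finite presentations from finite voltage automata *)

(** The states that are not [live] are those reached after leaving the graph of
interest; they keep [step] total.  A live state [j] stands for an orbit of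
vertices, the pair of [j] and [x : G] for one vertex of the derived graph, and
[(j, a)] for the orbit of the edges that lead from the vertex [(j, x)] to the
vertex [(step j a, x * volt (j, a))]. *)
Section VoltageGraph.
Variables (G : groupType) (J A : finType) (live : pred J).
Variables (step : J -> A -> J) (volt : J * A -> G).

Definition run (j : J) (w : freeMonoid A) : J := foldl step j w.

Fixpoint label (j : J) (w : seq A) : gword (J * A)%type :=
  if w is a :: w' then ((j, a), true) :: label (step j a) w' else [::].

Definition voltage (j : J) (w : freeMonoid A) : G :=
  gword_eval volt (label j w).

Lemma runM j (u v : freeMonoid A) : run j (u * v) = run (run j u) v.
Proof. exact: foldl_cat. Qed.

Lemma labelM j (u v : freeMonoid A) :
  label j (u * v) = label j u * label (run j u) v.
Proof.
by elim: u j => [//|a u IH] j; exact: (congr1 (cons _) (IH _)).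
Qed.

Lemma voltageM j (u v : freeMonoid A) :
  voltage j (u * v) = voltage j u * voltage (run j u) v.
Proof. by rewrite /voltage labelM gword_evalM. Qed.

Lemma voltage1 j : voltage j 1 = 1.
Proof. exact: gword_eval1. Qed.

Variables (E : seq (freeMonoid A * freeMonoid A)) (i0 : J).
Hypothesis live0 : live i0.
Hypothesis live_step : forall j a, live (step j a) -> live j.
Hypothesis volt_dead : forall j a, ~~ live (step j a) -> volt (j, a) = 1.
(* Strong connectedness of the derived graph. *)
Hypothesis connected : forall i j x, live i -> live j ->
  exists2 w, run i w = j & voltage i w = x.
(* Both sides of a relation spell paths of the derived graph with the same
   end; in particular if one stays in the graph then so does the other. *)
Hypothesis relation_lift : forall u v j, (u, v) \in E ->
  live (run j u) \/ live (run j v) ->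
  run j u = run j v /\ voltage j u = voltage j v.
(* A loop [w] of the derived graph need not be trivial modulo the relations,
   but it is absorbed by some [p] in front that returns to the orbit [i0]. *)
Hypothesis simply_connected : forall w, run i0 w = i0 -> voltage i0 w = 1 ->
  exists2 p, run i0 p = i0 & cong_gen (fun x y => (x, y) \in E) (p * w) p.

Lemma live_run j w : live (run j w) -> live j.
Proof. by elim: w j => [//|a w IH] j /IH; exact: live_step. Qed.

(** The default value [1] of [xget] is never reached between live states, by
[connected]. *)
Definition path i j : freeMonoid A :=
  xget 1 [set w | run i w = j /\ voltage i w = 1].

Lemma pathP i j :
  live i -> live j -> run i (path i j) = j /\ voltage i (path i j) = 1.
Proof.
move=> li lj; rewrite /path; case: xgetP => [w -> //|no].
by have [w wj w1] := connected 1 li lj; case: (no w).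
Qed.

(** The 2-cells; the chosen paths from and to the base state, which play the
part of a spanning tree; and the edges that leave the graph. *)
Definition relators : seq (gword (J * A)%type) :=
  [seq label j p.1 * gword_inv (label j p.2)
     | j <- enum J, p <- [seq p <- E | live (run j p.1)]]
  ++ [seq label i0 (path i0 j) | j <- enum J & live j]
  ++ [seq label j (path j i0) | j <- enum J & live j]
  ++ [seq [:: (x, true)] | x <- enum {: J * A} & ~~ live (step x.1 x.2)].

Local Notation "u ~ v" := (cong_gen (group_rel relators) u v) (at level 70).

Lemma relators_eval w : w \in relators -> gword_eval volt w = 1.
Proof.
rewrite !mem_cat => /or4P[/allpairsPdep|/mapP|/mapP|/mapP].
- move=> [j [[u v] [_]]]; rewrite mem_filter => /andP[/= lu uv] ->.
  rewrite gword_evalM gword_evalV -/(voltage j u) -/(voltage j v).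
  by have [_ ->] := relation_lift uv (or_introl lu); rewrite mulgV.
- by move=> [j]; rewrite mem_filter => /andP[lj _] ->; case: (pathP live0 lj).
- by move=> [j]; rewrite mem_filter => /andP[lj _] ->; case: (pathP lj live0).
- move=> [[j a]]; rewrite mem_filter => /andP[dead _] ->.
  by rewrite gword_eval_letter volt_dead.
Qed.

(** Rewriting a word whose path stays in the graph deforms that path across
2-cells.  Liveness of the end is what propagates along a derivation: it passes
to the other side of each relation by [relation_lift] and to prefixes by
[live_run]. *)
Lemma label_relation j (u v : freeMonoid A) :
  cong_gen (fun x y => (x, y) \in E) u v -> live (run j u) \/ live (run j v) ->
  run j u = run j v /\ label j u ~ label j v.
Proof.
move=> uv; elim: uv j => {u v}.
- move=> u v uv j l; have [ruv _] := relation_lift uv l; split=> //.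
  apply/gword_cong_div/cong_base/group_rel_relator; rewrite mem_cat.
  apply/orP; left; apply/allpairsPdep; exists j, (u, v); split=> //.
    by rewrite mem_enum.
  by rewrite mem_filter uv andbT; case: l; rewrite ruv.
- by move=> u j _; split=> //; exact: cong_refl.
- by move=> u v _ IH j /or_comm/IH[-> ?]; split=> //; exact: cong_sym.
- move=> u v w _ IHu _ IHv j [l|l].
    have [r uv] := IHu j (or_introl l); rewrite r in l *.
    have [-> vw] := IHv j (or_introl l); split=> //; exact: cong_trans uv vw.
  have [r vw] := IHv j (or_intror l); rewrite -r in l *.
  have [-> uv] := IHu j (or_intror l); split=> //; exact: cong_trans uv vw.
- move=> u u' v v' _ IHu _ IHv j; rewrite !runM => l.
  have [r uu] : run j u = run j u' /\ label j u ~ label j u'.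
    by apply: IHu; case: l => /live_run; [left|right].
  rewrite r in l *; have [r' vv] := IHv _ l; split=> //.
  by rewrite !labelM r; exact: cong_mul uu vv.
Qed.

(** Null-homotopy of the directed loops of the derived graph: since [p] returns
to [i0], the path of [p * w] is the path of [p] followed by that of [w], and
the former can be cancelled. *)
Lemma label_loop w : run i0 w = i0 -> voltage i0 w = 1 -> label i0 w ~ 1.
Proof.
move=> w0 w1; have [p p0 pw] := simply_connected w0 w1.
have [|_] := label_relation (j := i0) pw; first by rewrite p0; right.
by rewrite labelM p0 -[X in _ ~ X -> _]mulg1; exact: gword_cong_cancel.
Qed.

(** An edge becomes a loop at [i0] by adding the trivial connecting paths at
its ends.  For the inverse edge, connectedness closes this loop to a loop of
trivial voltage, and [label_loop] applies. *)
Lemma letter_label x b :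
  exists2 w, run i0 w = i0 & ([:: (x, b)] : gword _) ~ label i0 w.
Proof.
have [w w0 xw] : exists2 w, run i0 w = i0 &
    ([:: (x, true)] : gword _) ~ label i0 w.
  case: x => j a; have [l|dead] := boolP (live (step j a)); last first.
    exists 1 => //; apply/cong_base/group_rel_relator; rewrite !mem_cat.
    apply/or4P/Or44/mapP; exists (j, a) => //.
    by rewrite mem_filter dead mem_enum.
  have lj := live_step l.
  have [r1 _] := pathP live0 lj; have [r2 _] := pathP l live0.
  exists (path i0 j * (([:: a] : freeMonoid A) * path (step j a) i0)).
    by rewrite runM r1 runM.
  rewrite labelM r1 labelM.
  have c1 : label i0 (path i0 j) ~ 1.
    apply/cong_base/group_rel_relator; rewrite !mem_cat.
    by apply/or4P/Or42/map_f; rewrite mem_filter lj mem_enum.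
  have c2 : label (step j a) (path (step j a) i0) ~ 1.
    apply/cong_base/group_rel_relator; rewrite !mem_cat.
    by apply/or4P/Or43/map_f; rewrite mem_filter l mem_enum.
  have := cong_mul c1 (gword_cong_mull (label j [:: a]) c2).
  by rewrite mul1g mulg1; exact: cong_sym.
case: b; first by exists w.
have [v v0 vw] := connected (voltage i0 w)^-1 live0 live0.
exists v => //; apply: (@gword_cong_cancel _ _ [:: (x, true)]).
apply: cong_trans (cong_base (group_rel_cancel _ x true)) _.
apply: cong_sym; apply: cong_trans (gword_cong_mulr _ xw) _.
have := @label_loop (w * v); rewrite labelM w0; apply.
  by rewrite runM w0.
by rewrite voltageM w0 vw mulgV.
Qed.

Lemma gword_label (W : gword (J * A)%type) :
  exists2 w, run i0 w = i0 & W ~ label i0 w.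
Proof.
elim: W => [|[x b] W [w w0 Ww]]; first by exists 1 => //; exact: cong_refl.
have [v v0 xv] := letter_label x b; exists (v * w); first by rewrite runM v0.
by rewrite labelM v0; apply: cong_mul xv Ww.
Qed.

(** Completeness: a group word equals the path of a directed loop by
[gword_label]; if it evaluates to [1], that loop lifts to a loop of the derived
graph, which is trivial by [label_loop]. *)
Theorem fp_group_voltage : fp_group G.
Proof.
exists (J * A)%type, relators, volt; split=> [x|u v].
  by have [w _ wx] := connected x live0 live0; exists (label i0 w).
split; last exact: cong_relator_eval relators_eval u v.
move=> uv; apply/gword_cong_div.
have [w w0 Ww] := gword_label (u * gword_inv v).
apply: cong_trans (Ww) _; apply: label_loop => //.
rewrite /voltage -(cong_relator_eval relators_eval Ww).
by rewrite gword_evalM gword_evalV uv mulgV.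
Qed.

End VoltageGraph.

(** * The Schützenberger group acting on its R-class *)

Section SchutzAction.
Variables (S : semigroupType) (R : set S).
Hypotheses (RR : R_class R) (Rfin : finitely_many_H R).

Local Notation G := (schutz RR Rfin).
Local Notation R1 := (@inj1 S @` R).

(** The action is defined on the whole of [adj1 S] through a chosen
representative of [x] in the stabilizer; only on [R] and on right multiples of
[R] does it not depend on that choice. *)
Definition schutz_act (x : G) (m : adj1 S) : adj1 S :=
  val (repr (x : schutz_monoid R)) * m.

Lemma schutz_act_mulr x m y : schutz_act x m * y = schutz_act x (m * y).
Proof. by rewrite /schutz_act mulgA. Qed.

Lemma schutz_act_R1 x m : R1 m -> R1 (schutz_act x m).
Proof.
by move=> Rm; apply: (set_mem (valP (repr (x : schutz_monoid R)))); exists m.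
Qed.

Lemma schutz_act_pi (s : stabType R) m :
  R1 m -> schutz_act (\pi_(schutz_monoid R) s : schutz_monoid R) m = val s * m.
Proof.
move=> [r Rr <-]; rewrite /schutz_act.
have /eqmodP/asboolP/(_ _ Rr) := reprK (\pi_(schutz_monoid R) s).
exact.
Qed.

Lemma schutz_actM x y m :
  R1 m -> schutz_act (x * y) m = schutz_act x (schutz_act y m).
Proof.
by move=> Rm; rewrite (schutz_act_pi _ Rm) gmulfM -mulgA.
Qed.

Lemma schutz_act1 m : R1 m -> schutz_act 1 m = m.
Proof. by move=> Rm; rewrite (schutz_act_pi _ Rm) gmulf1 mul1g. Qed.

Lemma schutz_actK x m : R1 m -> schutz_act x^-1 (schutz_act x m) = m.
Proof. by move=> Rm; rewrite -schutz_actM // mulVg schutz_act1. Qed.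

Lemma R1_connected m m' : R1 m -> R1 m' -> exists y, m' = m * y.
Proof.
move=> [r Rr <-] [r' Rr' <-].
by have /greenRP[] := (R_classE r' RR Rr).1 Rr'.
Qed.

(** Convexity of [R] for paths: in the R-order [m * y] lies between [m] and
[m * y * z], which are R-related. *)
Lemma R1_mull m y z : R1 m -> R1 (m * y * z) -> R1 (m * y).
Proof.
move=> Rm Rmyz; have [u mu] := R1_connected Rmyz Rm.
have [r Rr rm] := Rm; have [q qE] : exists q, inj1 q = m * y.
  by rewrite -rm; case: (y) => [s|]; [exists (r * s)|exists r].
exists q => //; apply/(R_classE _ RR Rr)/greenRP; split.
  by exists y; rewrite qE rm.
by exists (z * u); rewrite qE mulgA -mu rm.
Qed.

(** Freeness: the elements of [R] are right multiples of any one of them, so two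
left translations that agree at one point of [R] agree on [R]. *)
Lemma schutz_act_inj m x y : R1 m -> schutz_act x m = schutz_act y m -> x = y.
Proof.
move=> Rm xy; rewrite -[x](@reprK _ (schutz_monoid R)).
rewrite -[y](@reprK _ (schutz_monoid R)); apply/eqmodP/asboolP => r Rr.
have [|z ->] := @R1_connected m (inj1 r) Rm; first by exists r.
by rewrite !mulgA; congr (_ * _).
Qed.

Lemma schutz_act_R1E x m y :
  R1 m -> R1 (schutz_act x (m * y)) <-> R1 (m * y).
Proof.
move=> Rm; split; last exact: schutz_act_R1.
move/(schutz_act_R1 x^-1).
rewrite -(schutz_act_mulr x) -(schutz_act_mulr _ (schutz_act x m)).
by rewrite schutz_actK.
Qed.

Lemma schutz_act_H x r r' : R r -> inj1 r' = schutz_act x (inj1 r) ->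
  greenH r r'.
Proof.
move=> Rr r'E; have Rm : R1 (inj1 r) by exists r.
have [q Rq /inj1_inj qr'] : R1 (inj1 r') by rewrite r'E; exact: schutz_act_R1.
split; last by apply/(R_classE _ RR Rr); rewrite -qr'.
apply/greenLP; split; first by eexists; exact: r'E.
by exists (val (repr (x^-1 : schutz_monoid R)));
   rewrite r'E -/(schutz_act _ _) schutz_actK.
Qed.

(** If [r'] is L-below [r] through [s] and lies in [R], then [s] stabilizes [R]:
any [q] in [R] is [r * y], and [s * q = r' * y] lies in [R] by convexity, since
a further right factor brings it back to [r']. *)
Lemma schutz_act_trans r r' : R r -> greenH r r' ->
  exists x, inj1 r' = schutz_act x (inj1 r).
Proof.
move=> Rr [/greenLP[[s sE] _] rRr']; have Rr' := (R_classE r' RR Rr).2 rRr'.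
have ss : stab R s.
  move=> _ [_ [q Rq <-] <-].
  have [y qy] := R1_connected (ex_intro2 _ _ r Rr erefl)
                              (ex_intro2 _ _ q Rq erefl).
  have [z rz] := R1_connected (ex_intro2 _ _ q Rq erefl)
                              (ex_intro2 _ _ r Rr erefl).
  have sq : s * inj1 q = inj1 r' * y by rewrite qy mulgA -sE.
  rewrite sq; apply: (@R1_mull _ _ z); first by exists r'.
  by rewrite -sq -mulgA -rz -sE; exists r'.
exists (\pi_(schutz_monoid R) (exist _ s (mem_set ss) : stabType R)).
by rewrite schutz_act_pi //; exists r.
Qed.

(** The H-classes in [R], as a finite type [I] together with an orbit map (with
value [None] outside [R]) and a choice of representatives.  The third clause is
stated for right multiples of [R] because the orbit of [m * y] is needed before
it is known whether [m * y] lies in [R]. *)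
Lemma finite_orbits : exists (I : finType) (orb : adj1 S -> option I)
    (rep : I -> adj1 S),
  [/\ forall m, orb m <-> R1 m,
      forall i, R1 (rep i) /\ orb (rep i) = Some i,
      forall x m y, R1 m -> orb (schutz_act x (m * y)) = orb (m * y) &
      forall m i, orb m = Some i -> exists x, m = schutz_act x (rep i)].
Proof.
have /finite_seqP[L LE] := Rfin.
have LP H : (H \in L) <-> H_class H /\ H `<=` R.
  by split=> [HL|HP]; [rewrite -[_ /\ _]/([set H | _] H) LE|
    move: (HP); rewrite -[_ /\ _]/([set H | H_class H /\ H `<=` R] H) LE].
pose hcl (m : adj1 S) := [set t | exists2 r, inj1 r = m & greenH r t].
have hclE r : hcl (inj1 r) = [set t | greenH r t].
  rewrite eqEsubset; split=> t; first by move=> [q /inj1_inj ->].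
  by exists r.
have hclL m : R1 m -> hcl m \in L.
  move=> [r Rr <-]; apply/LP; rewrite hclE; split; first by exists r.
  by move=> t [_ rt]; apply/(R_classE _ RR Rr).
pose orb m : option (seq_sub L) := if `[< R1 m >] then insub (hcl m) else None.
have orbE m (Rm : R1 m) : orb m = Some (SeqSub (hclL m Rm)).
  rewrite /orb asboolT // (insubT (fun H => H \in L) (hclL m Rm)).
  exact: erefl.
have orbP m : orb m <-> R1 m.
  split=> [|Rm]; last by rewrite orbE.
  by rewrite /orb; case: asboolP.
have repP (i : seq_sub L) : exists m, R1 m /\ orb m = Some i.
  have /LP[[s sE] iR] := valP i.
  have Rs : R1 (inj1 s) by exists s => //; apply: iR; rewrite sE.
  exists (inj1 s); split=> //; rewrite orbE; congr Some; apply: val_inj.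
  by rewrite /= hclE sE.
pose rep i := sval (cid (repP i)).
have repE i : R1 (rep i) /\ orb (rep i) = Some i by rewrite /rep; case: cid.
exists (seq_sub L), orb, rep; split=> // [x m y Rm|m i mi].
  have [Rmy|nRmy] := pselect (R1 (m * y)); last first.
    by rewrite /orb !asboolF // schutz_act_R1E.
  have Rxmy := schutz_act_R1 x Rmy.
  rewrite !orbE; congr Some; apply: val_inj => /=.
  have [r Rr rE] := Rmy; have [r' Rr' r'E] := Rxmy.
  rewrite -r'E -rE !hclE.
  have [L1 R1'] : greenH r r' by apply: schutz_act_H Rr _; rewrite r'E rE.
  by rewrite /greenH /greenL /greenR L1 R1'.
have Rm : R1 m by apply/orbP; rewrite mi.
have [Ri] := repE i; rewrite -{}mi !orbE => -[].
have [r Rr <-] := Rm; have [r' Rr' <-]:= Ri; rewrite !hclE => h.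
apply: schutz_act_trans Rr' _.
by have : [set t | greenH r t] r by []; rewrite -h.
Qed.

End SchutzAction.

(** * Words over a presentation of the semigroup *)

Section WordValues.
Variables (S : semigroupType) (A : finType).
Variable f : {multiplicative freeSemigroup A -> S}.

Definition word_val (w : freeMonoid A) : adj1 S :=
  \prod_(a <- w) inj1 (f (exist _ [:: a] isT)).

Lemma word_valM u v : word_val (u * v) = word_val u * word_val v.
Proof. exact: big_cat. Qed.

Lemma word_val_freeSemigroup (w : freeSemigroup A) :
  word_val (val w) = inj1 (f w).
Proof.
case: w => [[//|a w]] /=; elim: w a => [|b w IH] a w0.
  by rewrite /word_val big_seq1; congr (inj1 (f _)); apply: val_inj.
rewrite /word_val big_cons -/(word_val (b :: w)) (IH b isT) -inj1M -gmulfM.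
by congr (inj1 (f _)); apply: val_inj.
Qed.

Lemma word_val_surj :
  (forall s, exists w, f w = s) -> forall y, exists w, word_val w = y.
Proof.
move=> fsurj [s|]; last by exists 1; exact: big_nil.
by have [w <-] := fsurj s; exists (val w); exact: word_val_freeSemigroup.
Qed.

End WordValues.

Lemma cong_gen_freeMonoid (A : choiceType)
    (E : seq (freeSemigroup A * freeSemigroup A)) (u v : freeSemigroup A) :
  cong_gen (fun x y => (x, y) \in E) u v ->
  cong_gen (fun x y : freeMonoid A =>
      (x, y) \in
        [seq (val p.1 : freeMonoid A, val p.2 : freeMonoid A) | p <- E])
    (val u) (val v).
Proof.
elim=> {u v} [u v uv|u|u v _|u v w _ uv _|u u' v v' _ uu _ vv].
- by apply: cong_base; apply/mapP; exists (u, v).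
- exact: cong_refl.
- exact: cong_sym.
- exact: cong_trans uv.
- exact: (cong_mul uu vv).
Qed.

(** * The quotient automaton of an R-class *)

Section QuotientAutomaton.
Variables (S : semigroupType) (R : set S).
Hypotheses (RR : R_class R) (Rfin : finitely_many_H R).
Variables (A : finType) (f : {multiplicative freeSemigroup A -> S}).
Variables (I : finType) (orb : adj1 S -> option I) (rep : I -> adj1 S).

Local Notation G := (schutz RR Rfin).
Local Notation R1 := (@inj1 S @` R).
Local Notation ev := (word_val f).

Hypothesis orb_live : forall m, orb m <-> R1 m.
Hypothesis rep_R1 : forall i, R1 (rep i).
Hypothesis orb_rep : forall i, orb (rep i) = Some i.
Hypothesis orb_act : forall (x : G) m y,
  R1 m -> orb (schutz_act x (m * y)) = orb (m * y).
Hypothesis orb_trans : forall m i,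
  orb m = Some i -> exists x : G, m = schutz_act x (rep i).

Definition orbit_step (j : option I) (a : A) : option I :=
  if j is Some i then orb (rep i * ev [:: a]) else None.

(** The set below has exactly one element, because the action is free and
transitive on each orbit. *)
Definition orbit_volt (ja : option I * A) : G :=
  if ja.1 is Some i then
    if orbit_step ja.1 ja.2 is Some k then
      xget 1 [set x | rep i * ev [:: ja.2] = schutz_act x (rep k)]
    else 1
  else 1.

Local Notation orun := (run orbit_step).
Local Notation ovoltage := (voltage orbit_step orbit_volt).

Lemma run_None w : orun None w = None.
Proof. by elim: w. Qed.

(** The derived graph of the automaton is the graph on [R]: following [w] from
[i] computes [rep i * ev w]. *)
Lemma quotient_run i w : orun (Some i) w = orb (rep i * ev w) /\
  forall k, orun (Some i) w = Some k ->
    rep i * ev w = schutz_act (ovoltage (Some i) w) (rep k).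
Proof.
elim: w i => [|a w IH] i.
  have -> : ev [::] = 1 by exact: big_nil.
  by rewrite mulg1 orb_rep; split=> // k [<-]; rewrite voltage1 schutz_act1.
rewrite -[a :: w]/(([:: a] : freeMonoid A) * w) word_valM runM voltageM mulgA.
rewrite /run [foldl _ _ [:: a]]/= -/(run _ _ _).
have v1 : ovoltage (Some i) [:: a] = orbit_volt (Some i, a).
  exact: gword_eval_letter.
case ia: (orb (rep i * ev [:: a])) => [k|]; last first.
  rewrite run_None; split=> //; apply/esym.
  case wk: (orb _) => [k|//].
  have /orb_live/(R1_mull RR (rep_R1 i))/orb_live :
      orb (rep i * ev [:: a] * ev w).
    by rewrite wk.
  by rewrite ia.
have -> : rep i * ev [:: a] = schutz_act (ovoltage (Some i) [:: a]) (rep k).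
  rewrite v1 /orbit_volt /= ia; case: xgetP => [x -> //|no].
  by have [x xE] := orb_trans ia; case: (no x).
have [IHr IHv] := IH k; rewrite schutz_act_mulr orb_act //; split=> // l kl.
by rewrite (IHv l kl) schutz_actM.
Qed.

Lemma quotient_connected (fsurj : forall s, exists w, f w = s) i j (x : G) :
  exists2 w, orun (Some i) w = Some j & ovoltage (Some i) w = x.
Proof.
have Rx := schutz_act_R1 x (rep_R1 j).
have [y yE] := R1_connected RR (rep_R1 i) Rx.
have [w wy] := word_val_surj fsurj y; have [ri vi] := quotient_run i w.
have rj : orun (Some i) w = Some j.
  by rewrite ri wy -yE -[rep j]mulg1 orb_act // mulg1 orb_rep.
exists w => //; apply: (schutz_act_inj (rep_R1 j)).
by rewrite -vi // wy.
Qed.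

Lemma quotient_relation u v j : ev u = ev v ->
  isSome (orun j u) \/ isSome (orun j v) ->
  orun j u = orun j v /\ ovoltage j u = ovoltage j v.
Proof.
case: j => [i|]; last by rewrite !run_None => _ [].
move=> uv l; have [ru vu] := quotient_run i u; have [rv vv] := quotient_run i v.
have r : orun (Some i) u = orun (Some i) v by rewrite ru rv uv.
split=> //; have {l} : isSome (orun (Some i) v) by case: l; rewrite ?r.
case vk: (orun (Some i) v) => [k|//] _; apply: (schutz_act_inj (rep_R1 k)).
by rewrite -vu ?r // -vv // uv.
Qed.

(** The use of right abundance: the equations [e * e = e * 1] and
[r * w = r * 1] are exchanged between [e] and [r] by starL, giving [r * e = r]
and [e * w = e]. *)
Lemma quotient_simply_connected
    (E : seq (freeSemigroup A * freeSemigroup A)) i w :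
  right_abundant S -> (forall s, exists w, f w = s) ->
  (forall u v, f u = f v -> cong_gen (fun x y => (x, y) \in E) u v) ->
  orun (Some i) w = Some i -> ovoltage (Some i) w = 1 ->
  exists2 p, orun (Some i) p = Some i &
    cong_gen (fun x y : freeMonoid A =>
      (x, y) \in
        [seq (val q.1 : freeMonoid A, val q.2 : freeMonoid A) | q <- E])
    (p * w) p.
Proof.
move=> habund fsurj fE wi w1; have [_ /(_ i wi)] := quotient_run i w.
rewrite w1 schutz_act1 // => rw.
have [r _ rE] := rep_R1 i; rewrite -rE in rw.
have [e re ee] : exists2 e, starL r e & e * e = e by apply: habund; exists r.
have re_r : inj1 r * inj1 e = inj1 r.
  rewrite -[RHS]mulg1; apply/(re (inj1 e) 1).
  by rewrite -inj1M ee mulg1.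
have [p pe] := fsurj e.
exists (val p).
  have [-> _] := quotient_run i (val p).
  by rewrite word_val_freeSemigroup pe -rE re_r rE orb_rep.
(* The empty word is no element of the free semigroup. *)
have [->|w0] := eqVneq (w : seq A) [::].
  by rewrite mulg1; exact: cong_refl.
pose w' : freeSemigroup A := exist _ (w : seq A) w0.
apply: (@cong_gen_freeMonoid _ E (p * w') p); apply: fE.
apply: (@inj1_inj S); rewrite gmulfM inj1M pe -(word_val_freeSemigroup f w').
rewrite -[RHS]mulg1; apply/(re _ 1).
by rewrite mulg1.
Qed.

End QuotientAutomaton.

Theorem corollary1p3 (S : semigroupType) (hfp : fp_semigroup S)
    (habund : right_abundant S) (R : set S) (hR : R_class R)
    (hfin : finitely_many_H R) :
  fp_group (schutz hR hfin).
Proof.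
have [A [E [f [fsurj fE]]]] := hfp.
have [I [orb [rep [orbP repP orb_act orb_trans]]]] := finite_orbits hR hfin.
have rep_R1 i := (repP i).1; have orb_rep i := (repP i).2.
have [r0 R0] : exists r, R r by have [r ->] := hR; exists r.
have [i0 i0E] : exists i, orb (inj1 r0) = Some i.
  have /orbP : (@inj1 S @` R) (inj1 r0) by exists r0.
  by case: (orb _) => // i _; exists i.
pose E' := [seq (val p.1 : freeMonoid A, val p.2 : freeMonoid A) | p <- E].
apply: (@fp_group_voltage _ (option I) A isSome (orbit_step f orb rep)
  (orbit_volt hR hfin f orb rep) E' (Some i0)) => //.
- by case.
- by case=> [i|] a //; rewrite /orbit_volt /=; case: (orb _).
- by move=> [i|] [j|] x // _ _; exact: quotient_connected.
- move=> u v j /mapP[[u' v'] uv [-> ->]]; apply: quotient_relation => //.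
  rewrite !word_val_freeSemigroup; congr inj1.
  by apply/fE; exact: cong_base.
- move=> w; apply: quotient_simply_connected => // u v; exact: (fE u v).1.
Qed.
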